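(* Let $m$ be a positive integer such that $q=4m^2+1$ is a prime power $q=p^r$ with $p$ a prime congruent to $1$ modulo $4$. Let $k$ be the odd integer with $k\le \sqrt{q}<k+2$. Then there exists a conference matrix $W$ of order $q+1$ with maximum excess attaining the upper bound $$E(W)=\frac{(q+1)(k^2+2k+q)}{2(k+1)};$$ that is, $E(W)$ equals this value, and every conference matrix $W'$ of order $q+1$ satisfies $E(W')\le \frac{(q+1)(k^2+2k+q)}{2(k+1)}$.
   Context: A conference matrix of order $n$ is an $n\times n$ matrix $W$ with entries in $\{0,-1,1\}$ and zero diagonal satisfying $WW^T=(n-1)I$, where $I$ is the $n\times n$ identity matrix. The excess $E(W)$ is the sum of all entries of $W$. *)

(* Defs.v *)
From HB Require Import structures.
From mathcomp Require Import all_boot all_order all_algebra.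

Set Implicit Arguments.
Unset Strict Implicit.
Unset Printing Implicit Defensive.

Import Order.TTheory GRing.Theory Num.Theory.
Local Open Scope ring_scope.

(* [n%:Z - 1] is the integer difference, not truncated subtraction on [nat]. *)
Definition conference_matrix (n : nat) (W : 'M[int]_n) : Prop :=
  [/\ forall i j, W i j \in [:: 0; -1; 1],
      forall i, W i i = 0
    & W *m W^T = (n%:Z - 1)%:M].

Definition excess (n : nat) (W : 'M[int]_n) : int :=
  \sum_(i < n) \sum_(j < n) W i j.

(* The quotient is taken in [rat], so no integrality is presupposed. *)
Definition excess_bound (q : nat) (k : int) : rat :=
  ((q%:R + 1) * (k%:~R ^+ 2 + 2 * k%:~R + q%:R)) / (2 * (k%:~R + 1)).

(* Main.v *)
(** Let q = 4M + 1 and n = 2M + 1, and view L = F_(q^2) as a plane over F_q, with symplectic form [det]. Over one representative per line, the quadratic character of [det] is a symmetric conference matrix of order q + 1 = 2n. Taking the representatives in U and om U, where U is the group of n-th roots of unity and om is a non-square of L, makes the row sums equal to a + b on U and b - a on om U, with a^2 + b^2 = q.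
For M = m^2, the maximal excess is reached once {|a|, |b|} = {1, 2m}, after changing signs of rows. Modulo p, [a] is up to a unit the central binomial coefficient 'C(2M, M), which p does not divide; and the representations q = a^2 + b^2 = 1 + (2m)^2 with p not dividing [a] agree up to signs and order, because q = p^r divides (2ma - b)(2ma + b). *)
Require Import Defs.
From mathcomp Require Import all_boot all_order all_algebra all_field.
From mathcomp Require Import cyclic zify ring.

Set Implicit Arguments.
Unset Strict Implicit.
Unset Printing Implicit Defensive.

Import Order.TTheory GRing.Theory Num.Theory.
Local Open Scope ring_scope.

(** * The central binomial coefficient modulo p *)

(** In base [p] all [r] digits of [M] equal (p - 1)/4, so doubling [M] produces no carry; by
    Legendre's formula (2M)! and (M!)^2 then have the same [p]-adic valuation. *)
Lemma central_bin_ndvd (p r M : nat) :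
  prime p -> p = 1 %[mod 4] -> (4 * M + 1 = p ^ r)%N -> ~~ (p %| 'C(2 * M, M))%N.
Proof.
move=> pp p4 qE.
have pk4 k : (p ^ k %% 4 = 1)%N by rewrite -modnXm p4 modnXm exp1n.
have MleM2 : (M <= 2 * M)%N by lia.
have half k : ((2 * M) %/ p ^ k = 2 * (M %/ p ^ k))%N.
  have [ler|ltr] := leqP k r; last first.
    have : (p ^ r < p ^ k)%N by rewrite ltn_exp2l ?prime_gt1.
    by rewrite -qE => ltk; rewrite !divn_small; lia.
  have qk : (p ^ r = p ^ (r - k) * p ^ k)%N by rewrite -expnD subnK.
  have p1 := pk4 k; have p2 := pk4 (r - k)%N.
  set A := (p ^ k)%N in qk p1 *; set B := (p ^ (r - k))%N in qk p2; clearbody A B.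
  have [[c Ac] [d Bd]] : (exists c, A = 4 * c + 1)%N /\ (exists d, B = 4 * d + 1)%N.
    by split; [exists (A %/ 4)%N | exists (B %/ 4)%N]; lia.
  (* Here [c] is the remainder of [M] modulo [A], and 2c < A = 4c + 1. *)
  have ME : (M = d * A + c)%N by move: qE; rewrite qk Bd mulnDl mul1n -mulnA; lia.
  have A0 : (0 < A)%N by lia.
  rewrite ME mulnDr mulnA !divnMDl // !divn_small; lia.
have := congr1 (logn p) (bin_fact MleM2).
have -> : (2 * M - M = M)%N by lia.
rewrite !lognM ?muln_gt0 ?bin_gt0 ?fact_gt0 //.
rewrite !logn_fact //.
have -> : (\sum_(1 <= k < (2 * M).+1) (2 * M) %/ p ^ k
         = 2 * \sum_(1 <= k < M.+1) M %/ p ^ k)%N.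
  rewrite (@big_cat_nat _ _ _ M.+1) //=.
  rewrite [X in (_ + X)%N]big_nat_cond [X in (_ + X)%N]big1 ?addn0; last first.
    move=> k /andP[/andP[lk _] _]; rewrite half divn_small //.
    by apply: leq_trans (ltn_expl _ (prime_gt1 pp)); lia.
  by rewrite big_distrr /=; apply: eq_bigr => k _; rewrite half.
move=> H; have l0 : logn p 'C(2 * M, M) = 0%N by lia.
by rewrite -[p]expn1 pfactor_dvdn ?bin_gt0 // l0.
Qed.

(** * The field of order q^2 and its Frobenius map over F_q *)

Section PaleyLine.

Variables (L : finFieldType) (p r M : nat).
Local Notation q := (4 * M + 1)%N.
Local Notation n := (2 * M + 1)%N.
Hypotheses (pp : prime p) (p4 : p = 1 %[mod 4]) (qE : (q = p ^ r)%N).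
Hypothesis cardL : #|L| = (q ^ 2)%N.
Variable om : L.
Hypothesis om_prim : (8 * M * n).-primitive_root om.

Lemma M_gt0 : (0 < M)%N.
Proof. by have := finNzRing_gt1 L; rewrite cardL; case: M. Qed.

Lemma pcharL : p \in [pchar L].
Proof. by apply: (@card_finPcharP _ _ (r * 2)); rewrite ?cardL ?qE ?expnM. Qed.

(** The subfield F_q enters only as the set of fixed points of this additive map. *)
Lemma frobD (x y : L) : (x + y) ^+ q = x ^+ q + y ^+ q.
Proof.
apply: exprDn_pchar; rewrite qE pnatX orbC; apply/orP; right.
by rewrite pnatE // pcharL.
Qed.

Lemma frobN (x : L) : (- x) ^+ q = - x ^+ q.
Proof. by rewrite exprNn -signr_odd oddD oddM /= mulN1r. Qed.

Lemma frobK (x : L) : (x ^+ q) ^+ q = x.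
Proof. by rewrite -exprM mulnn -cardL expf_card. Qed.

Lemma two_neq0 : (2 : L) != 0.
Proof.
rewrite -(dvdn_pcharf pcharL); apply/negP => /dvdn_leq.
have := prime_gt1 pp; move: p4; move: pp; case: p => [|[|[|p']]] // *; lia.
Qed.

Lemma neg1_neq1 : (-1 : L) != 1.
Proof. by rewrite eq_sym -addr_eq0; exact: two_neq0. Qed.

Lemma om_neq0 : om != 0.
Proof.
apply/eqP => om0; have := prim_expr_order om_prim.
have := M_gt0; rewrite om0 expr0n => M0; case: eqP; first by lia.
by move=> _ /eqP; rewrite eq_sym oner_eq0.
Qed.

Lemma om_half : om ^+ (4 * M * n) = -1.
Proof.
have := prim_expr_order om_prim.
have -> : (8 * M * n = 4 * M * n * 2)%N by lia.
rewrite exprM => /eqP; rewrite sqrf_eq1 => /orP[|/eqP//].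
rewrite -(prim_order_dvd om_prim) => /dvdn_leq.
have := M_gt0; nia.
Qed.

Lemma exp_nonzero (x : L) : x != 0 -> x ^+ (8 * M * n) = 1.
Proof.
move=> x0; apply: (mulfI x0); rewrite mulr1 -exprS.
have -> : (8 * M * n).+1 = #|L| by rewrite cardL; lia.
exact: expf_card.
Qed.

Lemma sqrt_or_om (z : L) : z != 0 -> exists (b : bool) s, z = om ^+ b * s ^+ 2.
Proof.
move=> /exp_nonzero/(prim_rootP om_prim)[i ->].
exists (odd i), (om ^+ i./2).
by rewrite -exprM -exprD muln2 odd_double_half.
Qed.

(** * The symplectic form on the plane *)

Definition delta : L := om ^+ n.

Lemma delta_neq0 : delta != 0. Proof. by rewrite expf_neq0 ?om_neq0. Qed.

Lemma delta_frob : delta ^+ q = - delta.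
Proof.
rewrite exprD expr1 /delta -exprM mulnC om_half mulN1r //.
Qed.

(** Frobenius negates both the numerator and [delta], so the quotient lies in F_q. *)
Definition det (x y : L) := (x * y ^+ q - x ^+ q * y) / delta.

Lemma det_frob x y : det x y ^+ q = det x y.
Proof.
rewrite /det exprMn exprVn delta_frob frobD frobN !exprMn !frobK invrN; ring.
Qed.

Lemma detxx x : det x x = 0.
Proof. by rewrite /det; ring. Qed.

Lemma detC x y : det y x = - det x y.
Proof. by rewrite /det; ring. Qed.

Lemma det_linear x s t u v : s ^+ q = s -> t ^+ q = t ->
  det x (s * u + t * v) = s * det x u + t * det x v.
Proof. by move=> sq tq; rewrite /det frobD !exprMn sq tq; ring. Qed.

Lemma detZr x c y : c ^+ q = c -> det x (c * y) = c * det x y.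
Proof. by move=> cq; rewrite /det !exprMn cq; ring. Qed.

(** Multiplication by [z] is an F_q-linear map whose determinant is the norm of [z]. *)
Lemma detM z x y : det (z * x) (z * y) = z ^+ (q + 1) * det x y.
Proof. by rewrite /det !exprMn [z ^+ (q + 1)]exprD expr1; ring. Qed.

Lemma cramer x y z : det x y * z = det z y * x + det x z * y.
Proof. by rewrite /det; ring. Qed.

(** * The quadratic character of F_q *)

(** Euler's criterion, with 2M = (q - 1)/2. The function is total on [L], but is the quadratic
    character only on F_q; outside F_q it takes the default value -1. *)
Definition chi (x : L) : int :=
  if x == 0 then 0 else if x ^+ (2 * M) == 1 then 1 else -1.

Lemma chi0 : chi 0 = 0. Proof. by rewrite /chi eqxx. Qed.

Lemma chi1 : chi 1 = 1. Proof. by rewrite /chi oner_eq0 expr1n eqxx. Qed.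

Lemma chi_trit x : chi x \in [:: 0; -1; 1].
Proof. by rewrite /chi; case: ifP => // _; case: ifP. Qed.

Lemma chi_sq x : chi x ^+ 2 = (x != 0)%:R.
Proof. by rewrite /chi; case: ifP => // _; case: ifP. Qed.

Lemma Fq_euler (x : L) : x ^+ q = x -> x != 0 -> x ^+ (2 * M) = 1 \/ x ^+ (2 * M) = -1.
Proof.
move=> xq x0; have : (x ^+ (2 * M)) ^+ 2 = 1.
  rewrite -exprM; apply: (mulIf x0); rewrite mul1r -exprSr -[RHS]xq; congr (_ ^+ _); lia.
by move/eqP; rewrite sqrf_eq1 => /orP[]/eqP; [left|right].
Qed.

Lemma chiE (x : L) : x ^+ q = x -> (chi x)%:~R = x ^+ (2 * M) :> L.
Proof.
move=> xq; rewrite /chi; case: eqP => [->|/eqP x0].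
  by rewrite expr0n; have := M_gt0; case: eqP => //; lia.
by case: (Fq_euler xq x0) => ->; rewrite ?eqxx ?(negbTE neg1_neq1) ?rmorphN1.
Qed.

Lemma chiM (x y : L) : x ^+ q = x -> y ^+ q = y -> chi (x * y) = chi x * chi y.
Proof.
move=> xq yq; have [->|x0] := eqVneq x 0; first by rewrite mul0r chi0 mul0r.
have [->|y0] := eqVneq y 0; first by rewrite mulr0 chi0 mulr0.
rewrite /chi mulf_eq0 (negbTE x0) (negbTE y0) /= exprMn.
by case: (Fq_euler xq x0) => ->; case: (Fq_euler yq y0) => ->;
  rewrite ?mulrNN ?mulr1 ?mul1r ?eqxx ?(negbTE neg1_neq1).
Qed.

(** The exponent 2M is even because q = 1 modulo 4; this is what makes [w] symmetric. *)
Lemma chiN x : chi (- x) = chi x.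
Proof. by rewrite /chi oppr_eq0 exprNn -signr_odd oddM mul1r. Qed.

Lemma norm_frob (x : L) : (x ^+ (q + 1)) ^+ q = x ^+ (q + 1).
Proof. by rewrite (exprD _ q 1) expr1 exprMn frobK mulrC. Qed.

Lemma norm_om : chi (om ^+ (q + 1)) = -1.
Proof.
rewrite /chi expf_eq0 (negbTE om_neq0) andbF -exprM.
have -> : ((q + 1) * (2 * M) = 4 * M * n)%N by lia.
by rewrite om_half (negbTE neg1_neq1).
Qed.

(** * Orthogonality over the whole plane *)

Definition w x y := chi (det x y).

Lemma wC x y : w x y = w y x. Proof. by rewrite /w detC chiN. Qed.

Lemma w_scale (x c y : L) : c ^+ q = c -> c != 0 -> w x (c * y) = chi c * w x y.
Proof. by move=> cq c0; rewrite /w detZr // chiM ?det_frob. Qed.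

Lemma wM z x y : w (z * x) (z * y) = chi (z ^+ (q + 1)) * w x y.
Proof. by rewrite /w detM chiM ?det_frob ?norm_frob. Qed.

(* The substitution multiplies [det x z] by the non-square [om ^+ (q + 1)] and fixes [det y z], so the sum equals its own opposite. *)
Lemma w_orth_full x y : det x y != 0 -> \sum_z w x z * w y z = 0.
Proof.
move=> d0; pose e := om ^+ (q + 1); pose d := det x y.
have eq : e ^+ q = e by exact: norm_frob.
have e0 : e != 0 by rewrite expf_neq0 ?om_neq0.
pose f z := (e * det x z / d) * y + (- det y z / d) * x.
have c1 z : (e * det x z / d) ^+ q = e * det x z / d.
  by rewrite 2!exprMn exprVn !det_frob eq.
have c2 z : (- det y z / d) ^+ q = - det y z / d.
  by rewrite exprMn exprVn frobN !det_frob.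
have fx z : det x (f z) = e * det x z.
  by rewrite det_linear // detxx mulr0 addr0 divfK.
have fy z : det y (f z) = det y z.
  by rewrite det_linear // detxx mulr0 add0r (detC x y) mulrN mulNr mulNr opprK divfK.
have f_inj : injective f.
  move=> z z' fz; have Ex := congr1 (det x) fz; have Ey := congr1 (det y) fz.
  rewrite !fx in Ex; rewrite !fy in Ey; move/(mulfI e0): Ex => Ex.
  by apply: (mulfI d0); rewrite !(cramer x y) ![det _ y]detC Ex Ey.
set S := \sum_z _; have : S = - S.
  rewrite {1}/S (reindex_inj f_inj) -sumrN; apply: eq_bigr => z _.
  by rewrite /w fx fy chiM ?det_frob // norm_om mulN1r mulNr.
by lia.
Qed.

(** * Representatives of the lines *)

Definition U := [set v : L | v ^+ n == 1].
Definition R := U :|: [set om * v | v in U].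

Lemma U_neq0 v : v \in U -> v != 0.
Proof.
by rewrite inE; apply: contraL => /eqP->; rewrite expr0n addn1 eq_sym oner_eq0.
Qed.

Lemma UM u v : u \in U -> v \in U -> u * v \in U.
Proof. by rewrite !inE exprMn => /eqP-> /eqP->; rewrite mulr1. Qed.

Lemma UV u : u \in U -> u^-1 \in U.
Proof. by rewrite !inE exprVn => /eqP->; rewrite invr1. Qed.

Lemma U_norm v : v \in U -> v ^+ (q + 1) = 1.
Proof.
rewrite inE => /eqP vn; have -> : (q + 1 = n * 2)%N by lia.
by rewrite exprM vn expr1n.
Qed.

Lemma UZ_mem u v : u \in U -> (u * v \in U) = (v \in U).
Proof.
move=> Uu; apply/idP/idP => [/(UM (UV Uu))|]; last exact: UM.
by rewrite mulKf ?U_neq0.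
Qed.

Lemma U_prim : n.-primitive_root (om ^+ (8 * M)).
Proof.
have -> : (8 * M = 8 * M * n %/ n)%N by rewrite mulnK; lia.
by apply: dvdn_prim_root => //; apply: dvdn_mull.
Qed.

Lemma card_U : #|U| = n.
Proof.
have zP := U_prim.
have f_inj : injective (fun i : 'I_n => (om ^+ (8 * M)) ^+ i).
  move=> i j /eqP; rewrite (eq_prim_root_expr zP) !modn_small // => /eqP.
  exact: val_inj.
rewrite -[RHS]card_ord -(card_imset _ f_inj); apply: eq_card => v.
rewrite inE; apply/eqP/imsetP => [/(prim_rootP zP)[i ->]|[i _ ->]].
  by exists i.
by rewrite exprAC (prim_expr_order zP) expr1n.
Qed.

(** The power 4Mn sends [U] and the nonzero elements of F_q to 1, but [om] to -1. *)
Lemma om_cross (u v c : L) : u \in U -> v \in U -> c ^+ q = c -> u != c * (om * v).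
Proof.
rewrite !inE => /eqP Uu /eqP Uv cq; apply/eqP => E.
have c0 : c != 0.
  by apply/eqP => c0; move: Uu; rewrite E c0 mul0r expr0n addn1 => /eqP; rewrite eq_sym oner_eq0.
have cn : c ^+ (4 * M) = 1.
  by apply: (mulIf c0); rewrite -exprSr mul1r -[RHS]cq; congr (_ ^+ _); lia.
have := congr1 (fun x => x ^+ (4 * M * n)) E.
have kill (x : L) : x ^+ n = 1 -> x ^+ (4 * M * n) = 1.
  by move=> xn; rewrite mulnC (exprM x n) xn expr1n.
rewrite /= !exprMn om_half (exprM c (4 * M)) cn expr1n mul1r !kill // => /eqP.
by rewrite mulr1 eq_sym (negbTE neg1_neq1).
Qed.

(** The order of [c] divides both [n] and 4M, which are coprime since [n] is odd. *)
Lemma U_scale (u v c : L) : u \in U -> v \in U -> c ^+ q = c -> u = c * v -> u = v.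
Proof.
move=> Uu Uv cq E.
have Uc : c \in U by rewrite -(UZ_mem _ Uv) mulrC -E.
have c0 := U_neq0 Uc; move: Uc; rewrite inE => /eqP cn.
have c4 : c ^+ (4 * M) = 1.
  by apply: (mulIf c0); rewrite -exprSr mul1r -[RHS]cq; congr (_ ^+ _); lia.
have c2 : c ^+ 2 = 1.
  have : (c ^+ n) ^+ 2 = 1 by rewrite cn expr1n.
  have -> : (c ^+ n) ^+ 2 = c ^+ (4 * M) * c ^+ 2 by rewrite -exprM -exprD; congr (_ ^+ _); lia.
  by rewrite c4 mul1r.
by move: cn; rewrite exprD exprM c2 expr1n mul1r expr1 E => ->; rewrite mul1r.
Qed.

Lemma R_scale (x y c : L) : x \in R -> y \in R -> c ^+ q = c -> x = c * y -> x = y.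
Proof.
move=> Rx Ry cq; have [->|c0] := eqVneq c 0.
  move=> x0; move: Rx; rewrite x0 mul0r => /setUP[/U_neq0/eqP//|/imsetP[v Uv /eqP]].
  by rewrite eq_sym mulf_eq0 (negbTE om_neq0) (negbTE (U_neq0 Uv)).
have cVq : c^-1 ^+ q = c^-1 by rewrite exprVn cq.
case/setUP: Rx => [Ux|/imsetP[u Uu ->]]; case/setUP: Ry => [Uy|/imsetP[v Uv ->]].
- exact: U_scale.
- by move/eqP; rewrite (negbTE (om_cross Ux Uv cq)).
- move=> E; have /eqP := om_cross Uy Uu cVq; case.
  by rewrite E mulKf.
by rewrite mulrCA => /(mulfI om_neq0)/(U_scale Uu Uv cq)->.
Qed.

Lemma R_neq0 x : x \in R -> x != 0.
Proof.
case/setUP => [/U_neq0//|/imsetP[v /U_neq0 v0 ->]].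
by rewrite mulf_neq0 ?om_neq0.
Qed.

Lemma det_R x y : x \in R -> y \in R -> (det x y == 0) = (x == y).
Proof.
move=> Rx Ry; apply/eqP/eqP => [|->]; last exact: detxx.
move/eqP; rewrite mulf_eq0 invr_eq0 (negbTE delta_neq0) orbF subr_eq0 => /eqP E.
have y0 := R_neq0 Ry; apply: (@R_scale _ _ (x / y)) => //; last by rewrite divfK.
rewrite exprMn exprVn; apply: (mulIf (expf_neq0 q y0)); rewrite divfK ?expf_neq0 //.
by apply: (mulIf y0); rewrite mulrAC divfK // E.
Qed.

Lemma R_cover (z : L) : z != 0 -> exists c : L, [/\ c ^+ q = c, c != 0 & c * z \in R].
Proof.
move=> z0; have [b [s zE]] := sqrt_or_om z0.
have {z0} s0 : s != 0 by apply: contraNneq z0 => s0; rewrite zE s0 expr0n mulr0.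
rewrite {}zE.
(* Dividing s^2 by the norm of [s], a scalar of F_q, gives an element of norm 1. Hence t^n is 1 or
   -1, and since [n] is odd a sign [e] moves [t] into [U]. *)
pose t := s ^+ 2 / s ^+ (q + 1).
have t2 : (t ^+ n) ^+ 2 = 1.
  rewrite -exprM; have -> : (n * 2 = q + 1)%N by lia.
  rewrite exprMn exprVn (exprAC s 2); set N := s ^+ (q + 1).
  by rewrite (exprD N q 1) expr1 norm_frob -/N expr2 divff // mulf_neq0 ?expf_neq0.
have [e e2 Ut] : exists2 e : L, e = 1 \/ e = -1 & e * t \in U.
  have /orP[/eqP tn|/eqP tn] : (t ^+ n == 1) || (t ^+ n == -1) by rewrite -sqrf_eq1 t2.
    by exists 1; [left|rewrite mul1r inE tn].
  exists (-1); [by right|]; rewrite inE mulN1r exprNn tn -signr_odd oddD oddM /=.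
  by rewrite mulrNN mulr1.
have eq : e ^+ q = e by case: e2 => ->; rewrite ?expr1n // frobN expr1n.
have e0 : e != 0 by case: e2 => ->; rewrite ?oppr_eq0 oner_eq0.
exists (e / s ^+ (q + 1)); split.
- by rewrite exprMn exprVn norm_frob eq.
- by rewrite mulf_neq0 ?invr_eq0 ?expf_neq0.
have -> : e / s ^+ (q + 1) * (om ^+ b * s ^+ 2) = om ^+ b * (e * t) by rewrite /t; ring.
by rewrite inE; case: b; rewrite /= ?expr0 ?mul1r ?Ut // expr1 imset_f ?orbT.
Qed.

(** Double counting: each nonzero [z] has exactly one nonzero scalar [c] in F_q with [c * z] in
    [R]. *)
Lemma sum_R (f : L -> int) : f 0 = 0 -> (forall c z : L, c ^+ q = c -> c != 0 -> f (c * z) = f z) ->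
  \sum_z f z = #|[pred c : L | (c ^+ q == c) && (c != 0%R)]|%:R * \sum_(z in R) f z :> int.
Proof.
move=> f0 fc; set P := [pred c | _].
have one z : z != 0 -> \sum_(c | P c && (c * z \in R)) 1 = 1 :> int.
  move=> z0; have [c [cq c0 cR]] := R_cover z0.
  rewrite (bigD1 c) /= ?cq ?eqxx ?c0 // big1 ?addr0 // => d.
  move=> /andP[/andP[/andP[/eqP dq d0] dR] dc].
  case/eqP: dc; apply: (mulIf z0); apply: (@R_scale _ _ (d / c)) => //.
    by rewrite exprMn exprVn cq dq.
  by rewrite mulrA divfK.
transitivity (\sum_z \sum_(c | P c && (c * z \in R)) f (c * z)).
  apply: eq_bigr => z _; have [->|z0] := eqVneq z 0.
    by rewrite f0 big1 // => c _; rewrite mulr0 f0.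
  rewrite (eq_bigr (fun=> f z * 1)) -?big_distrr /= ?one ?mulr1 // => c.
  by case/andP => /andP[/eqP cq c0] _; rewrite fc ?mulr1.
rewrite (exchange_big_dep P) /=; last by move=> z c _ /andP[].
rewrite (eq_bigr (fun=> \sum_(z in R) f z)) ?sumr_const ?mulr_natl //.
move=> c Pc; have /andP[_ c0] := Pc.
by rewrite [RHS](reindex_inj (mulfI c0)); apply: eq_bigl => z; rewrite Pc.
Qed.

(** Scaling [z] by [c] multiplies the product by chi(c)^2 = 1, so the vanishing sum over the plane
    descends to [R]. *)
Lemma w_orth x y : x \in R -> y \in R -> x != y -> \sum_(z in R) w x z * w y z = 0.
Proof.
move=> Rx Ry xy; have : det x y != 0 by rewrite det_R.
move/w_orth_full; rewrite sum_R.
- move/eqP; rewrite mulf_eq0 => /orP[|/eqP//].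
  rewrite pnatr_eq0 -leqn0 leqNgt => /card_gt0P[]; exists 1.
  by rewrite inE expr1n eqxx oner_eq0.
- by rewrite /w /det expr0n addn1 /= !mulr0 subr0 mul0r chi0 mul0r.
move=> c z cq c0; rewrite !w_scale // mulrACA -expr2 chi_sq c0 mul1r //.
Qed.

Lemma sum_setR (f : L -> int) :
  \sum_(z in R) f z = \sum_(v in U) f v + \sum_(v in U) f (om * v).
Proof.
rewrite (eq_bigl [predU U & [set om * v | v in U]]) => [|z]; last by rewrite !inE.
rewrite bigU /=; last first.
  rewrite -setI_eq0; apply/eqP/setP => z; rewrite in_set0; apply/negP.
  case/setIP => Uz /imsetP[v Uv E].
  by have := om_cross Uz Uv (expr1n _ _); rewrite mul1r E eqxx.
by rewrite big_imset //= => u v _ _ /(mulfI om_neq0).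
Qed.

Lemma card_R : #|R| = (q + 1)%N.
Proof.
have := sum_setR (fun=> 1); rewrite !sumr_const card_U => E.
have : (#|R|%:R : int) = n%:R + n%:R by rewrite -E.
lia.
Qed.

(** * The row sums *)

Definition rowA := \sum_(v in U) w 1 v.
Definition rowB := \sum_(v in U) w 1 (om * v).

Lemma sum_U_mul (f : L -> int) u : u \in U -> \sum_(v in U) f (u * v) = \sum_(v in U) f v.
Proof.
move=> Uu; rewrite [RHS](reindex_inj (mulfI (U_neq0 Uu))).
by apply: eq_bigl => v; rewrite UZ_mem.
Qed.

Lemma row_U x : x \in U -> \sum_(z in R) w x z = rowA + rowB.
Proof.
move=> Ux; rewrite sum_setR -(sum_U_mul _ Ux) -(sum_U_mul (fun v => w x (om * v)) Ux).
congr (_ + _); apply: eq_bigr => v _; rewrite ?[om * _]mulrCA -{1}[x]mulr1 wM.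
  by rewrite U_norm // chi1 mul1r.
by rewrite U_norm // chi1 mul1r.
Qed.

Lemma row_omU y : y \in U -> \sum_(z in R) w (om * y) z = rowB - rowA.
Proof.
move=> Uy; rewrite sum_setR -(sum_U_mul _ Uy) -(sum_U_mul (fun v => w _ (om * v)) Uy).
congr (_ + _).
  (* After inverting [v], the arguments y/v and om y = (y/v)(om v) share the factor y/v of norm 1,
     which leaves [w 1 (om * v)]. *)
  rewrite [LHS](reindex_inj (@invr_inj L)) /rowB /=.
  apply: eq_big => [v|v]; first by apply/idP/idP => /UV; rewrite ?invrK.
  move=> UvV; have Uv := UV UvV; rewrite invrK in Uv.
  rewrite wC -[om * y](_ : y * v^-1 * (om * v) = _).
    by rewrite -{1}[y * v^-1]mulr1 wM U_norm ?chi1 ?mul1r // UM.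
  by rewrite [om * v]mulrC mulrA mulfVK ?U_neq0 // mulrC.
rewrite /rowA -sumrN; apply: eq_bigr => v _.
rewrite mulrA -{1}[om * y]mulr1 wM exprMn (U_norm Uy) mulr1 norm_om mulN1r //.
Qed.

Lemma w_diag x : x \in R -> \sum_(z in R) w x z * w x z = q%:Z.
Proof.
move=> Rx; rewrite (bigD1 x) //= {1 2}/w detxx chi0 mul0r add0r.
rewrite (eq_bigr (fun=> 1)); last first.
  by move=> z /andP[Rz zx]; rewrite -expr2 chi_sq det_R // eq_sym zx.
rewrite sumr_const; have := card_R; rewrite (cardD1 x) Rx => E.
rewrite (eq_card (B := [predD1 R & x])) ?natz; last first.
  by move=> z; rewrite [LHS]unfold_in [RHS]unfold_in andbC.
by move: E; rewrite [(q + 1)%N]addn1 add1n => -[->].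
Qed.

(** By orthogonality the squared row sums total q(q + 1). They are [n] copies each of (a + b)^2 and
    (b - a)^2, and 2n = q + 1. *)
Lemma sum_sq_rows : rowA ^+ 2 + rowB ^+ 2 = q%:Z.
Proof.
have : \sum_(z in R) (\sum_(x in R) w x z) ^+ 2 = q%:Z * (q + 1)%:Z.
  under eq_bigr => z _ do rewrite expr2 big_distrlr /=.
  rewrite exchange_big /= -card_R -[Posz #|R|]natz -sumr_const.
  rewrite big_distrr /=; apply: eq_bigr => x Rx; rewrite mulr1.
  rewrite exchange_big /= (bigD1 x) //= w_diag // big1 ?addr0 // => y /andP[Ry yx].
  by rewrite w_orth // eq_sym.
under eq_bigr => z _ do under eq_bigr => x _ do rewrite wC.
rewrite sum_setR (eq_bigr (fun=> (rowA + rowB) ^+ 2)); last by move=> x /row_U->.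
rewrite [X in _ + X](eq_bigr (fun=> (rowB - rowA) ^+ 2)); last by move=> x /row_omU->.
rewrite !sumr_const card_U -mulrnDl -mulr_natl natz => E.
have n0 : (2 * n)%:Z != 0 by lia.
apply: (mulIf n0); have -> : (2 * n)%N = (q + 1)%N by lia.
have : (q + 1)%:Z = 2 * n%:Z by lia.
by move=> nE; rewrite -E nE; ring.
Qed.

(** * The first row sum modulo p *)

Lemma sum_U_expr e : ~~ (n %| e)%N -> \sum_(v in U) v ^+ e = 0.
Proof.
rewrite (prim_order_dvd U_prim); set u := om ^+ (8 * M) => ue.
have Uu : u \in U by rewrite inE (prim_expr_order U_prim).
set S := \sum_(v in U) _; have : u ^+ e * S = S.
  rewrite {2}/S (reindex_inj (mulfI (U_neq0 Uu))) big_distrr /=.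
  by apply: eq_big => [v|v _]; rewrite ?UZ_mem ?exprMn.
move/eqP; rewrite -subr_eq0 -{2}[S]mul1r -mulrBl mulf_eq0 subr_eq0 (negbTE ue).
by move/eqP.
Qed.

(* Euler's criterion turns [rowA] into a power sum over the n-th roots of unity, in which only the middle binomial term survives. *)
Lemma rowA_ndvd : ~~ (p %| rowA)%Z.
Proof.
have E : rowA%:~R * delta ^+ (2 * M) = n%:R * ((-1) ^+ M * 'C(2 * M, M)%:R) :> L.
  rewrite /rowA rmorph_sum /= big_distrl /=.
  transitivity (\sum_(v in U) \sum_(i < (2 * M).+1)
      (-1) ^+ i * 'C(2 * M, i)%:R * v ^+ (q * (2 * M - i) + i)).
    apply: eq_bigr => v _; rewrite chiE ?det_frob // -exprMn /det divfK ?delta_neq0 //.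
    rewrite mul1r expr1n mul1r exprBn; apply: eq_bigr => i _.
    rewrite -mulr_natl (exprD v (q * (2 * M - i))) (exprM v q) !mulrA.
    by rewrite ['C(_, _)%:R * _]mulrC.
  have hM : (M < (2 * M).+1)%N by lia.
  rewrite exchange_big (bigD1 (Ordinal hM)) //= [X in _ + X]big1 ?addr0.
    rewrite -big_distrr /= (eq_bigr (fun=> 1)) ?sumr_const ?card_U; last first.
      move=> v Uv; have -> : (q * (2 * M - M) + M = (q + 1) * M)%N by lia.
      by rewrite exprM U_norm // expr1n.
    by rewrite mulrC.
  move=> i iM; rewrite -big_distrr /= sum_U_expr ?mulr0 //.
  have i2 := ltn_ord i; have {}iM : (i : nat) <> M by move=> E; case/eqP: iM; apply: val_inj.
  (* Since q = -1 modulo [n], the exponent is congruent to 2(i - M), whose absolute value is at most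
     2M < n. *)
  have Ee : (q * (2 * M - i) + i + 2 * M = n * (2 * (2 * M - i)) + 2 * i)%N by nia.
  apply/negP => /dvdnP[c Ec]; move: Ee; rewrite Ec.
  set a := (2 * (2 * M - i))%N; move=> Ee.
  have : (c < a \/ c = a \/ a < c)%N by lia.
  case=> [lt|[eq|lt]].
  - have : (c * n + n <= n * a)%N by nia.
    lia.
  - by move: Ee; rewrite eq; lia.
  have : (n * a + n <= c * n)%N by nia.
  lia.
apply/negP => /dvdzP[c Ec]; have := E.
have p0 : p%:R = 0 :> L by apply/eqP; rewrite -(dvdn_pcharf pcharL).
rewrite Ec rmorphM /= -pmulrn p0 mulr0 mul0r => /esym/eqP.
rewrite !mulf_eq0 signr_eq0 -(dvdn_pcharf pcharL 'C(_, _)) /=.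
rewrite (negbTE (central_bin_ndvd pp p4 qE)) orbF => /eqP n0.
(* [n] cannot vanish in [L]: 2n = q + 1, and [q] is a multiple of [p]. *)
have : (q + 1)%:R = n%:R * 2 :> L by rewrite -natrM; congr (_%:R); lia.
rewrite n0 mul0r qE natrD natrX p0 expr0n.
case: eqP => [r0|_ /eqP]; last by rewrite add0r oner_eq0.
by have := M_gt0; have := qE; rewrite r0 expn0; lia.
Qed.


(** * The signed matrix and its excess *)

Definition paley_row (i : 'I_(q + 1)) : L := enum_val (cast_ord (esym card_R) i).

Lemma paley_rowP i : paley_row i \in R.
Proof. exact: enum_valP. Qed.

Lemma paley_row_inj : injective paley_row.
Proof. by move=> i j /enum_val_inj/cast_ord_inj. Qed.

Lemma sum_paley_row (f : L -> int) : \sum_i f (paley_row i) = \sum_(z in R) f z.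
Proof.
rewrite [RHS]big_enum_val [RHS](reindex (cast_ord (esym card_R))) //=.
by exists (cast_ord card_R) => i _; rewrite ?cast_ordK ?cast_ordKV.
Qed.

(** Rows of negative sum are negated: orthogonality is kept, and each row contributes the absolute
    value of its sum to the excess. *)
Definition paley : 'M[int]_(q + 1) := \matrix_(i, j)
  ((-1) ^+ (\sum_(z in R) w (paley_row i) z < 0)%R * w (paley_row i) (paley_row j)).

Lemma paley_conference : conference_matrix paley.
Proof.
split=> [i j|i|].
- rewrite mxE /w; have := chi_trit (det (paley_row i) (paley_row j)).
  by case: (_ < 0); rewrite ?expr0 ?mul1r // expr1 mulN1r !inE => /or3P[]/eqP->.
- by rewrite mxE /w detxx chi0 mulr0.
apply/matrixP => i j; rewrite !mxE.
set s := fun i => (-1) ^+ (\sum_(z in R) w (paley_row i) z < 0)%R : int.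
transitivity (s i * s j * \sum_(z in R) w (paley_row i) z * w (paley_row j) z).
  by rewrite -sum_paley_row big_distrr; apply: eq_bigr => k _; rewrite !mxE mulrACA.
have [->|ij] := eqVneq i j; last first.
  by rewrite w_orth ?paley_rowP ?mulr0 ?mulr0n // (inj_eq paley_row_inj).
by rewrite w_diag ?paley_rowP // -expr2 sqrr_sign mul1r mulr1n; lia.
Qed.

Lemma excess_paley :
  excess paley = n%:Z * (`|rowA + rowB| + `|rowB - rowA|).
Proof.
transitivity (\sum_(x in R) `|\sum_(z in R) w x z|).
  rewrite -sum_paley_row; apply: eq_bigr => i _.
  by rewrite normrEsign -[X in _ * X]sum_paley_row big_distrr; apply: eq_bigr => j _; rewrite mxE.
rewrite sum_setR (eq_bigr (fun=> `|rowA + rowB|)); last by move=> x /row_U->.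
rewrite [X in _ + X](eq_bigr (fun=> `|rowB - rowA|)); last by move=> x /row_omU->.
by rewrite !sumr_const card_U -mulrnDl -mulr_natl natz.
Qed.

End PaleyLine.

(** * Choice of the field and of a generator *)

Lemma has_primitive_element (L : finFieldType) :
  exists z : L, #|L|.-1.-primitive_root z.
Proof.
pose rs := [seq x <- enum L | x != 0].
have szrs : size rs = #|L|.-1.
  rewrite size_filter; have := count_predC (pred1 (0 : L)) (enum L).
  rewrite -cardE (count_uniq_mem _ (enum_uniq _)) mem_enum inE add1n => <- /=.
  exact: eq_count.
have L1 : (0 < #|L|.-1)%N by rewrite -ltnS prednK ?finNzRing_gt1 // ltnW ?finNzRing_gt1.
have rs1 : all #|L|.-1.-unity_root rs.
  apply/allP => x; rewrite mem_filter unity_rootE => /andP[x0 _].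
  by apply/eqP/(mulfI x0); rewrite mulr1 -exprS prednK ?expf_card // ltnW ?finNzRing_gt1.
have urs : uniq rs by rewrite filter_uniq ?enum_uniq.
have := has_prim_root L1 rs1 urs; rewrite szrs leqnn => /(_ isT)/hasP[z _ zP].
by exists z.
Qed.

Lemma conference_of_prime_power (p r M : nat) :
  prime p -> p = 1 %[mod 4] -> (4 * M + 1 = p ^ r)%N -> (0 < r)%N ->
  exists (W : 'M[int]_(4 * M + 1 + 1)) (a b : int),
    [/\ conference_matrix W, a ^+ 2 + b ^+ 2 = (4 * M + 1)%:Z, ~~ (p %| a)%Z
      & excess W = (2 * M + 1)%:Z * (`|a + b| + `|b - a|)].
Proof.
move=> pp p4 qE r0.
have r2 : (0 < r * 2)%N by rewrite muln_gt0 r0.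
have [L _ cL] := pPrimePowerField pp r2.
have cardL : #|L| = ((4 * M + 1) ^ 2)%N by rewrite cL qE expnM.
have [om] := has_primitive_element L.
have -> : #|L|.-1 = (8 * M * (2 * M + 1))%N by rewrite cardL; lia.
move=> omP; exists (paley pp p4 qE cardL omP), (rowA M om), (rowB M om); split.
- exact: paley_conference.
- exact: (sum_sq_rows pp p4 qE).
- exact: (rowA_ndvd pp p4 qE).
exact: excess_paley.
Qed.

(** * Representations of q as a sum of two squares *)

(* With [x = 2ma + b] and [y = 2mb - a], [x ^+ 2 + y ^+ 2 = q ^+ 2], so [q %| x] forces [x = 0] or [y = 0]. *)
Lemma sum_two_squares_dvd (m : nat) (a b : int) : (0 < m)%N ->
  a ^+ 2 + b ^+ 2 = 4 * m%:Z ^+ 2 + 1 ->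
  (4 * m%:Z ^+ 2 + 1 %| 2 * m%:Z * a + b)%Z ->
  `|a + b| + `|b - a| = 4 * m%:Z.
Proof.
move=> m0 ab /dvdzP[t xE]; set Q := 4 * m%:Z ^+ 2 + 1 in ab xE.
have Q0 : 0 < Q by rewrite /Q; nia.
have sq1 (x : int) : x ^+ 2 = 1 -> x = 1 \/ x = -1.
  by move/eqP; rewrite sqrf_eq1 => /orP[]/eqP; [left|right].
have E : (t * Q) ^+ 2 + (2 * m%:Z * b - a) ^+ 2 = Q ^+ 2.
  transitivity (Q * (a ^+ 2 + b ^+ 2)); last by rewrite ab expr2.
  by rewrite -xE /Q; ring.
have [t0|t0] := eqVneq t 0.
  have bE : b = - (2 * m%:Z * a) by rewrite t0 in xE; lia.
  have : a ^+ 2 * Q = 1 * Q by rewrite mul1r -[RHS]ab bE /Q; ring.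
  move/(mulIf (lt0r_neq0 Q0)) => /sq1[] aE; rewrite bE aE; lia.
have yE : 2 * m%:Z * b - a = 0.
  have t2 : 1 <= t ^+ 2 by rewrite -gtz0_ge1 exprn_even_gt0.
  apply/eqP; rewrite -sqrf_eq0 eq_le sqr_ge0 andbT.
  have : Q ^+ 2 <= t ^+ 2 * Q ^+ 2 by rewrite ler_peMl ?sqr_ge0.
  by rewrite -exprMn -{1}E gerDl.
have aE : a = 2 * m%:Z * b by lia.
have : b ^+ 2 * Q = 1 * Q by rewrite mul1r -[RHS]ab aE /Q; ring.
move/(mulIf (lt0r_neq0 Q0)) => /sq1[] bE; rewrite aE bE; lia.
Qed.

Lemma sum_two_squares_prime_power (p r m : nat) (a b : int) : (0 < m)%N ->
  prime p -> (4 * m ^ 2 + 1 = p ^ r)%N ->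
  a ^+ 2 + b ^+ 2 = (4 * m ^ 2 + 1)%:Z -> ~~ (p %| a)%Z ->
  `|a + b| + `|b - a| = 4 * m%:Z.
Proof.
move=> m0 pp qE; have -> : (4 * m ^ 2 + 1)%:Z = 4 * m%:Z ^+ 2 + 1 by lia.
move=> ab pa; set Q := 4 * m%:Z ^+ 2 + 1 in ab.
have Qpr : Q = p%:Z ^+ r by rewrite /Q; lia.
have r0 : (0 < r)%N by case: r qE {Qpr} => //; rewrite expn0; lia.
have pQ : (p %| Q)%Z by rewrite Qpr -(prednK r0) exprS dvdz_mulr.
pose x := 2 * m%:Z * a + b; pose y := 2 * m%:Z * a - b.
have Qxy : (Q %| x * y)%Z.
  (* xy = 4m^2 a^2 - b^2 = Q a^2 - (a^2 + b^2) = Q(a^2 - 1). *)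
  apply/dvdzP; exists (a ^+ 2 - 1); rewrite /x /y.
  by rewrite mulrBl mul1r -{2}ab /Q; ring.
have cop (z : int) : ~~ (p %| z)%Z -> coprimez Q z.
  by rewrite Qpr coprimez_pexpl // coprimezE dvdzE /= prime_coprime.
have [py|/cop py] := boolP (p %| y)%Z; last first.
  by apply: sum_two_squares_dvd => //; rewrite -/Q -(Gauss_dvdzl x py).
(* If [p] divided both factors it would divide x + y = 4ma, hence [m], hence Q - 4m^2 = 1. *)
have /cop px : ~~ (p %| x)%Z.
  apply/negP => px; have : (p %| x + y)%Z by rewrite rpredD.
  have -> : x + y = a * (4 * m%:Z) by rewrite /x /y; ring.
  rewrite dvdzE abszM Euclid_dvdM // -!dvdzE (negbTE pa) /= => pm.
  have : (p %| Q - m%:Z * (4 * m%:Z))%Z by rewrite rpredB // dvdz_mull.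
  have -> : Q - m%:Z * (4 * m%:Z) = 1 by rewrite /Q; ring.
  by rewrite dvdzE dvdn1 gtn_eqF ?prime_gt1.
(* Replacing [b] by -b swaps the two absolute values and turns [y] into [x]. *)
have -> : `|a + b| + `|b - a| = `|a - b| + `|- b - a|.
  by rewrite addrC distrC -[- b - a]opprD normrN (addrC b).
apply: sum_two_squares_dvd; rewrite ?sqrrN //.
by rewrite -/Q -(Gauss_dvdzr y px).
Qed.

(** * The upper bound for the excess *)

(** The squares in a row total n - 1, so the nonnegative defects [t k] sum to zero and each
    vanishes. *)
Lemma conference_offdiag (n : nat) (W : 'M[int]_n) i j :
  conference_matrix W -> i != j -> W i j = 1 \/ W i j = -1.
Proof.
case=> ent diag WW ij.
pose t k := 1 - (k == i)%:R - W i k ^+ 2.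
have t_ge0 k : true -> 0 <= t k.
  move=> _; rewrite /t; have [->|_] := eqVneq k i; first by rewrite diag; lia.
  by have := ent i k; rewrite !inE => /or3P[]/eqP->.
have row_sq : \sum_k W i k ^+ 2 = n%:Z - 1.
  have := congr1 (fun A : 'M_n => A i i) WW; rewrite /= !mxE eqxx mulr1n => <-.
  by apply: eq_bigr => k _; rewrite mxE expr2.
have : \sum_k t k = 0.
  rewrite !sumrB row_sq sumr_const card_ord natz.
  rewrite (bigD1 i) //= eqxx big1 ?addr0 ?subrr // => k /negbTE->//.
move/(psumr_eq0P t_ge0)/(_ j isT); rewrite /t eq_sym (negbTE ij).
by have := ent i j; rewrite !inE => /or3P[]/eqP-> //; [right|left].
Qed.

Lemma sum_col_sq (n : nat) (W : 'M[int]_n) :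
  conference_matrix W -> \sum_j (\sum_i W i j) ^+ 2 = (n%:Z - 1) * n%:Z.
Proof.
case=> _ _ WW.
under eq_bigr => j _ do rewrite expr2 big_distrlr /=.
rewrite exchange_big /= (eq_bigr (fun=> n%:Z - 1)); last first.
  move=> i _; rewrite exchange_big (eq_bigr (fun k => (W *m W^T) i k)); last first.
    by move=> k _; rewrite mxE; apply: eq_bigr => j _; rewrite mxE.
  by rewrite WW (bigD1 i) //= big1 => [|k ki]; rewrite mxE ?eqxx ?addr0 // eq_sym (negbTE ki).
by rewrite sumr_const card_ord -mulr_natr natz.
Qed.

Lemma col_parity (n : nat) (W : 'M[int]_n) j :
  conference_matrix W -> exists d, \sum_i W i j = n%:Z - 1 + 2 * d.
Proof.
move=> cW; have [_ diag _] := cW.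
(* Start from n - 1 entries equal to 1; each entry -1 lowers the sum by 2. *)
exists (- \sum_(i | i != j) (W i j == -1)%:R).
rewrite (bigD1 j) //= diag add0r mulrN big_distrr /= -sumrN.
have -> : n%:Z - 1 = \sum_(i < n | i != j) 1.
  rewrite sumr_const cardC1 card_ord natz; case: n j {W cW diag} => [[]//|n] _; lia.
rewrite -big_split /=; apply: eq_bigr => i ij.
by case: (conference_offdiag cW ij) => ->.
Qed.

(* Column sums [c] are odd, hence [(c - (2m - 1)) * (c - (2m + 1)) >= 0]; sum this over the columns. *)
Lemma excess_le (n m : nat) (W : 'M[int]_n) :
  conference_matrix W -> ~~ odd n ->
  4 * m%:Z * excess W <= (n%:Z + 4 * m%:Z ^+ 2 - 2) * n%:Z.
Proof.
move=> cW n_even; pose c j := \sum_i W i j.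
have ineq j : 4 * m%:Z * c j <= c j ^+ 2 + (4 * m%:Z ^+ 2 - 1).
  have [d] := col_parity j cW; rewrite -/(c j) => cE.
  (* In terms of [e], the difference of the two sides is 4e(e + 1). *)
  have [e ->] : exists e, c j = 2 * m%:Z + 1 + 2 * e.
    by exists (n./2%:Z - 1 + d - m%:Z); rewrite cE; lia.
  have : 0 <= e * (e + 1) by case: (leP 0 e) => h; nia.
  nia.
have -> : excess W = \sum_j c j by rewrite /excess exchange_big.
rewrite big_distrr /=; apply: le_trans (ler_sum _ (fun j _ => ineq j)) _.
rewrite big_split /= sum_col_sq // sumr_const card_ord -[_ *+ n]mulr_natr natz.
by rewrite le_eqVlt; apply/orP; left; apply/eqP; ring.
Qed.

(** * The value of k, and the conclusion *)

(** The root of [q] lies strictly between 2m and 2m + 1, which leaves 2m - 1 and 2m for [k]; parity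
    decides. *)
Lemma odd_floor_sqrt (m : nat) (k : int) (q := (4 * m ^ 2 + 1)%N) :
  (0 < m)%N -> ~~ (2 %| k)%Z ->
  k%:~R <= sqrtC (q%:R : algC) < (k + 2)%:~R -> k = 2 * m%:Z - 1.
Proof.
move=> m0 kodd /andP[k1 k2].
have sqrC_nat (x : nat) : sqrtC (x ^ 2)%:R = x%:R :> algC by rewrite natrX sqrCK ?ler0n.
have lo : (2 * m)%:R < sqrtC (q%:R : algC).
  by rewrite -(sqrC_nat (2 * m)%N) ltr_sqrtC ?nnegrE ?ler0n // ltr_nat /q; lia.
have hi : sqrtC (q%:R : algC) < (2 * m + 1)%:R.
  by rewrite -(sqrC_nat (2 * m + 1)%N) ltr_sqrtC ?nnegrE ?ler0n // ltr_nat /q; lia.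
have : k < (2 * m + 1)%:Z by rewrite -(ltr_int algC); exact: le_lt_trans k1 hi.
have : (2 * m)%:Z < k + 2 by rewrite -(ltr_int algC); exact: lt_trans lo k2.
move: kodd; lia.
Qed.

(** Here k + 1 = 2m and k^2 + 2k + q = 8m^2, so the quotient is 2m(q + 1). *)
Lemma excess_boundE (m : nat) : (0 < m)%N ->
  excess_bound (4 * m ^ 2 + 1) (2 * m%:Z - 1) = (2 * m%:Z * (4 * m ^ 2 + 2)%:Z)%:~R.
Proof.
move=> m0; have mQ : m%:R != 0 :> rat by rewrite pnatr_eq0 -lt0n.
rewrite /excess_bound !(natrD, natrM, natrX, rmorphB, rmorphD, rmorphM, rmorphXn) /=.
by rewrite -?pmulrn; field; rewrite subrK mulf_neq0.
Qed.

Theorem theorem1p2 (m p r q : nat) (k : int)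
    (hm : (0 < m)%N) (hq : q = (4 * m ^ 2 + 1)%N)
    (hp : prime p) (hp4 : p = 1 %[mod 4]) (hqp : q = (p ^ r)%N)
    (hkodd : ~~ (2 %| k)%Z)
    (hk : k%:~R <= sqrtC (q%:R : algC) < (k + 2)%:~R) :
  exists W : 'M[int]_(q + 1),
    [/\ conference_matrix W,
        (excess W)%:~R = excess_bound q k
      & forall W' : 'M[int]_(q + 1),
          conference_matrix W' -> (excess W')%:~R <= excess_bound q k].
Proof.
subst q; have -> : k = 2 * m%:Z - 1 by apply: odd_floor_sqrt hk.
have r0 : (0 < r)%N by case: r hqp => //; rewrite expn0; lia.
have [W [a [b [cW ab pa eW]]]] := conference_of_prime_power hp hp4 hqp r0.
exists W; split=> //; rewrite excess_boundE //.
  rewrite eW (sum_two_squares_prime_power hm hp hqp ab pa).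
  by congr _%:~R; lia.
move=> W' cW'; rewrite ler_int.
have N_even : ~~ odd (4 * m ^ 2 + 1 + 1) by lia.
have m4 : 0 < 4 * m%:Z by lia.
(* At order N = 4m^2 + 2 the factor N + 4m^2 - 2 equals 8m^2 = 4m * 2m. *)
rewrite -(ler_pM2l m4); apply: le_trans (excess_le m cW' N_even) _.
by rewrite le_eqVlt; apply/orP; left; apply/eqP; lia.
Qed.
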